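(* Let $F$ be a field of characteristic $2$, and let $p$ and $q$ be anisotropic quasilinear quadratic forms of dimension $\geq 2$ over $F$ such that $q_{F(p)}$ is isotropic. Then, up to replacing $F$ with a purely transcendental extension of itself, there exists an anisotropic quasilinear quadratic form $\tau$ over $F(p)$ such that (1) $\dim(\tau) = \mathfrak{i}_0(q_{F(p)})$, and (2) $(p_1 \otimes \tau)_{\mathrm{an}} \subset (q_{F(p)})_{\mathrm{an}}$. Explicitly: there exist a purely transcendental field extension $L/F$ and an anisotropic quasilinear form $\tau$ over $L(p)$ with $\dim(\tau)=\mathfrak{i}_0(q_{L(p)})$ such that $\big((p_L)_1\otimes\tau\big)_{\mathrm{an}}$ is a subform of $(q_{L(p)})_{\mathrm{an}}$.
   Context: Quasilinear form (char $2$): an additive quadratic form, equivalently $\langle a_1,\dots,a_n\rangle:(\lambda_i)\mapsto\sum a_i\lambda_i^2$; tensor product $\langle a_i\rangle\otimes\langle b_j\rangle\simeq\langle a_ib_j\rangle$. $\mathfrak{i}_0(\phi)$ is the maximal dimension of a totally isotropic subspace; for quasilinear $\phi$ the isotropic vectors form a subspace $U$ and the anisotropic part $\phi_{\mathrm{an}}$ is the induced form on $V_\phi/U$ (so $\dim\phi_{\mathrm{an}}=\dim\phi-\mathfrak{i}_0(\phi)$). $F(p)$ is the function field of the projective quadric $\{p=0\}$ and $L(p)$ that of $\{p_L=0\}$. The first higher anisotropic kernel of $p$ is $p_1:=(p_{F(p)})_{\mathrm{an}}$, a form over $F(p)$. $\psi\subset\phi$ means $\psi$ is a subform: $\phi\simeq\psi\perp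 r$ for some form $r$. *)

(* Defs.v *)
From HB Require Import structures.
From mathcomp Require Import all_boot all_order all_algebra.
From mathcomp Require Import boolp classical_sets.
From mathcomp Require Import mpoly.

Set Implicit Arguments.
Unset Strict Implicit.
Unset Printing Implicit Defensive.

Import GRing.Theory.
Local Open Scope ring_scope.

(* A quasilinear form of dimension n is given by its coefficients: the row    *)
(* a : 'rV[F]_n stands for <a_1, ..., a_n>, with values [qval a].  By         *)
(* [quasilinear_diag] below this covers all additive quadratic forms, and     *)
(* scalar extension along iota is [map_mx iota].                              *)

Section Forms.
Variable F : fieldType.
Implicit Types (n m : nat).

Definition qval n (a v : 'rV[F]_n) : F := \sum_(i < n) a 0 i * v 0 i ^+ 2.

Definition isotropic n (a : 'rV[F]_n) : Prop :=
  exists2 v : 'rV[F]_n, v != 0 & qval a v = 0.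

Definition anisotropic n (a : 'rV[F]_n) : Prop := ~ isotropic a.

(* Subspaces of 'rV[F]_n are row spaces of square matrices. *)
Definition totally_isotropic n (a : 'rV[F]_n) (U : 'M[F]_n) : Prop :=
  forall v : 'rV[F]_n, (v <= U)%MS -> qval a v = 0.

Definition isotropy_index n (a : 'rV[F]_n) : nat :=
  \max_(d < n.+1 | `[< exists2 U : 'M[F]_n,
                         totally_isotropic a U & \rank U = d >]) d.

Definition isometric n m (a : 'rV[F]_n) (b : 'rV[F]_m) : Prop :=
  exists P : 'M[F]_(n, m),
    [/\ row_free P, row_full P & forall v, qval b (v *m P) = qval a v].

Definition orthogonal_sum n m (a : 'rV[F]_n) (b : 'rV[F]_m) : 'rV[F]_(n + m) :=
  row_mx a b.

Definition subform m n (b : 'rV[F]_m) (a : 'rV[F]_n) : Prop :=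
  exists k (r : 'rV[F]_k), isometric a (orthogonal_sum b r).

Definition tensor n m (a : 'rV[F]_n) (b : 'rV[F]_m) : 'rV[F]_(n * m) :=
  mxvec (\matrix_(i < n, j < m) (a 0 i * b 0 j)).

(* The subspace of all isotropic vectors; in characteristic 2 it exists by    *)
(* [isotropic_spaceP], otherwise the default 0 may be returned.               *)
Definition isotropic_space n (a : 'rV[F]_n) : 'M[F]_n :=
  xget 0 [set U : 'M[F]_n |
           forall v : 'rV[F]_n, (v <= U)%MS <-> qval a v = 0]%classic.

(* The projection 'rV[F]_n -> 'rV[F]_n / U with U the space above: right      *)
(* multiplication by a matrix of full column rank whose kernel is U.          *)
Definition an_proj n (a : 'rV[F]_n) :
    'M[F]_(n, \rank (cokermx (isotropic_space a))) :=
  col_base (cokermx (isotropic_space a)).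

(* The induced form on the quotient: the rows of [pinvmx (an_proj a)] lift    *)
(* the standard basis of the quotient.  See [qval_an].                        *)
Definition an n (a : 'rV[F]_n) : 'rV[F]_(\rank (cokermx (isotropic_space a))) :=
  \row_i qval a (row i (pinvmx (an_proj a))).

Lemma qvalZ n (a v : 'rV[F]_n) c : qval a (c *: v) = c ^+ 2 * qval a v.
Proof.
by rewrite /qval mulr_sumr; apply: eq_bigr => i _; rewrite mxE exprMn mulrCA.
Qed.

Lemma qval0 n (a : 'rV[F]_n) : qval a 0 = 0.
Proof. by rewrite -(scale0r 0) qvalZ expr0n mul0r. Qed.

Hypothesis F2 : 2%N \in [pchar F].

Lemma qvalD n (a u v : 'rV[F]_n) : qval a (u + v) = qval a u + qval a v.
Proof.
rewrite /qval -big_split; apply: eq_bigr => i _ /=.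
by rewrite mxE -mulrDr sqrrD -mulr_natr (pcharf0 F2) mulr0 addr0.
Qed.

Lemma qval_sum n (a : 'rV[F]_n) I (r : seq I) (P : pred I) (v : I -> 'rV[F]_n) :
  qval a (\sum_(i <- r | P i) v i) = \sum_(i <- r | P i) qval a (v i).
Proof. exact: (big_morph _ (@qvalD n a) (@qval0 n a)). Qed.

Lemma isotropic_spaceP n (a v : 'rV[F]_n) :
  (v <= isotropic_space a)%MS <-> qval a v = 0.
Proof.
suff [U0 HU0] : exists U : 'M[F]_n,
    forall v : 'rV[F]_n, (v <= U)%MS <-> qval a v = 0.
  rewrite /isotropic_space; case: xgetP => [U _ HU|noU]; first exact: HU.
  by case: (noU U0).
have tiP (U : 'M[F]_n) : totally_isotropic a U <->
    forall i, qval a (row i U) = 0.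
  split=> [tiU i|zU w /submxP[x ->]]; first by rewrite tiU ?row_sub.
  by rewrite mulmx_sum_row qval_sum big1 // => i _; rewrite qvalZ zU mulr0.
pose Q d := `[< exists2 U : 'M[F]_n, totally_isotropic a U & \rank U = d >].
have Q0 : exists d, Q d.
  exists 0%N; apply/asboolP; exists 0; rewrite ?mxrank0 // => w.
  by rewrite submx0 => /eqP ->; rewrite qval0.
have Qn d : Q d -> (d <= n)%N by move=> /asboolP[U _ <-]; apply: rank_leq_row.
case: (ex_maxnP Q0 Qn) => d /asboolP[U tiU rU] dmax.
exists U => w; split=> [/tiU //|zw].
have tiUw : totally_isotropic a (U + w)%MS.
  move=> x /sub_addsmxP[[y z] /= ->].
  rewrite qvalD tiU ?submxMl // add0r.
  by rewrite [z]mx11_scalar mul_scalar_mx qvalZ zw mulr0.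
have le_r : (\rank (U + w)%MS <= \rank U)%N.
  by rewrite rU dmax //; apply/asboolP; exists (U + w)%MS.
apply: submx_trans (addsmxSr U w) _.
have := mxrank_leqif_sup (addsmxSl U w).
by move=> [le_ eq_]; rewrite -eq_ eqn_leq le_ le_r.
Qed.

Lemma an_proj_full n (a : 'rV[F]_n) : row_full (an_proj a).
Proof. exact: col_base_full. Qed.

Lemma an_proj_ker n (a v : 'rV[F]_n) : v *m an_proj a = 0 <-> qval a v = 0.
Proof.
have e : v *m cokermx (isotropic_space a) =
    v *m an_proj a *m row_base (cokermx (isotropic_space a)).
  by rewrite -mulmxA mulmx_base.
rewrite -isotropic_spaceP submxE e; split=> [->|/eqP]; first by rewrite mul0mx.
rewrite -(mul0mx _ (row_base (cokermx (isotropic_space a)))).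
by apply: row_free_inj; apply: row_base_free.
Qed.

Lemma qval_an n (a v : 'rV[F]_n) : qval (an a) (v *m an_proj a) = qval a v.
Proof.
set w := v *m _.
have -> : qval (an a) w = qval a (w *m pinvmx (an_proj a)).
  rewrite mulmx_sum_row qval_sum; apply: eq_bigr => i _.
  by rewrite qvalZ mxE mulrC.
have e : (w *m pinvmx (an_proj a) - v) *m an_proj a = 0.
  by rewrite mulmxBl -[w *m _ *m _]mulmxA mulVpmx ?an_proj_full // mulmx1 subrr.
have /an_proj_ker z := e.
by rewrite -[w *m _](subrK v) qvalD z add0r.
Qed.

Lemma anisotropic_an n (a : 'rV[F]_n) : anisotropic (an a).
Proof.
case=> w nz_w zw; move/eqP: nz_w; apply.
rewrite -[w]mulmx1 -(mulVpmx (an_proj_full a)) mulmxA.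
by apply/an_proj_ker; rewrite -qval_an -mulmxA (mulVpmx (an_proj_full a)) mulmx1.
Qed.

End Forms.

Lemma quasilinear_diag (F : fieldType) (n : nat) (f : 'rV[F]_n -> F) :
  (forall c v, f (c *: v) = c ^+ 2 * f v) ->
  (forall u v, f (u + v) = f u + f v) ->
  f =1 qval (\row_i f (delta_mx 0 i)).
Proof.
move=> fZ fD v; have f0 : f 0 = 0 by rewrite -(scale0r 0) fZ expr0n mul0r.
rewrite {1}[v]row_sum_delta (big_morph f fD f0).
by apply: eq_bigr => i _; rewrite fZ mxE mulrC.
Qed.

Section FieldExtensions.
Variables (F K : fieldType) (iota : {rmorphism F -> K}).

(* K = F(S) *)
Definition field_generated (S : K -> Prop) : Prop :=
  forall D : {pred K}, divring_closed D ->
    (forall c, iota c \in D) -> (forall y, S y -> y \in D) ->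
  forall y, y \in D.

Definition algebraically_independent (B : K -> Prop) : Prop :=
  forall k (t : 'I_k -> K), injective t -> (forall i, B (t i)) ->
  forall P : {mpoly F[k]}, (map_mpoly iota P).@[t] = 0 -> P = 0.

Definition purely_transcendental : Prop :=
  exists2 B : K -> Prop, algebraically_independent B & field_generated B.

Definition quadric_poly n (p : 'rV[F]_n) : {mpoly F[n]} :=
  \sum_(i < n) p 0 i *: 'X_i ^+ 2.

(* K (with its embedding iota) is the function field of the projective        *)
(* quadric {p = 0}: there is a K-point x of projective space whose         *)
(* homogeneous vanishing ideal is (p), i.e. the generic point of the quadric, *)
(* and it is generated over F by the rational functions x_i / x_j.  So K is   *)
(* identified with the field of homogeneous fractions of degree 0 of          *)
(* F[X]/(p), and is determined up to F-isomorphism.                           *)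
Definition is_quadric_function_field n (p : 'rV[F]_n) : Prop :=
  exists x : 'I_n -> K,
    [/\ exists i, x i != 0,
        forall d (f : {mpoly F[n]}), f \is d.-homog ->
          ((map_mpoly iota f).@[x] = 0 <-> exists g, f = g * quadric_poly p)
      & field_generated (fun y => exists i j, x j != 0 /\ y = x i / x j)].

(* p_1 *)
Definition first_kernel n (p : 'rV[F]_n) := an (map_mx iota p).

End FieldExtensions.

(* Main.v *)
Require Import Defs.
From HB Require Import structures.
From mathcomp Require Import all_boot all_order all_algebra.
From mathcomp Require Import boolp classical_sets.
From mathcomp Require Import mpoly ring.

Import GRing.Theory.
Local Open Scope ring_scope.

(** No transcendental extension is needed: L = F works.  Let x be the generic
   point of {p = 0} over K = F(p), and lift a basis of the isotropic vectors of
   q_K to vectors f_1, ..., f_d of homogeneous polynomials in F[X].  Since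
   q(f_k) vanishes at x, it factors as q(f_k) = p h_k, and
   tau = <h_1(x), ..., h_d(x)>.
   - Comparing coefficients of t^2 after the substitution X |-> x + t e_i gives
     a_i h_k(x) = q((d f_k / d X_i)(x)), where p = <a_1, ..., a_n>.  Hence all
     values of p_1 (x) tau are values of q_K, which for the anisotropic parts
     means that one is a subform of the other.
   - If tau were isotropic, some f, a combination of the f_k over F[X] with
     f(x) <> 0, would have q(f) divisible by p^2; as q stays anisotropic over
     F(X), this forces p to divide f, so f(x) = 0. *)

(** * Squares of polynomials in characteristic 2 *)

Lemma sqr_sum_pchar2 (R : comNzRingType) (R2 : 2%N \in [pchar R])
    (I : Type) (r : seq I) (P : pred I) (f : I -> R) :
  (\sum_(i <- r | P i) f i) ^+ 2 = \sum_(i <- r | P i) f i ^+ 2.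
Proof.
rewrite -(pFrobenius_autE R2) rmorph_sum.
by apply: eq_bigr => i _; rewrite /= pFrobenius_autE.
Qed.

(** Squaring is additive, so [f ^+ 2] is the sum of the squares of the terms of [f]. *)
Lemma coef_sqr_pchar2 (R : comNzRingType) (R2 : 2%N \in [pchar R])
    (f : {poly R}) (k : nat) : (f ^+ 2)`_(k * 2) = f`_k ^+ 2.
Proof.
have P2 : 2%N \in [pchar {poly R}] by rewrite pchar_poly.
rewrite -[f in LHS]coefK poly_def (sqr_sum_pchar2 _ P2) coef_sum.
under eq_bigr => i _ do
  rewrite exprZn -exprM coefZ coefXn eqn_mul2r /= mulr_natr mulrb.
case: (ltnP k (size f)) => [ltk|lek].
  rewrite (bigD1 (Ordinal ltk)) //= eqxx big1 ?addr0 // => i ne_ik.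
  by rewrite ifN_eqC // eq_sym.
rewrite big1 => [|i _]; first by rewrite nth_default // expr0n.
by rewrite ifN // gtn_eqF // (leq_trans (ltn_ord i)).
Qed.

Lemma mcoeff_sqr_pchar2 (R : comNzRingType) (R2 : 2%N \in [pchar R])
    (n : nat) (f : {mpoly R[n]}) (k : 'X_{1..n}) :
  (f ^+ 2)@_(k *+ 2) = f@_k ^+ 2.
Proof.
have P2 : 2%N \in [pchar {mpoly R[n]}].
  exact: (rmorph_pchar (@mpolyC n R) R2).
have mul2I (u v : 'X_{1..n}) : ((u *+ 2)%MM == (v *+ 2)%MM) = (u == v).
  apply/eqP/eqP => [/mnmP e|-> //]; apply/mnmP => i.
  by apply/eqP; rewrite -(eqn_pmul2r (m := 2)) // -!mulmnE e.
rewrite {1}[f]mpolyE (sqr_sum_pchar2 _ P2) raddf_sum /=.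
under eq_bigr => i _ do
  rewrite exprZn mcoeffZ mcoeffXn mul2I mulr_natr mulrb.
case: (boolP (k \in msupp f)) => [kf|kNf].
  rewrite (bigD1_seq k) ?msupp_uniq //= eqxx big1 ?addr0 // => i ne_ik.
  by rewrite ifN.
rewrite memN_msupp_eq0 // expr0n big_seq big1 // => i i_f.
by rewrite ifN //; apply: contraNneq kNf => <-.
Qed.

(** * Anisotropy over polynomial rings *)

Section DiagonalAnisotropy.
Variables (m : nat).

Definition ring_anisotropic (R : comNzRingType) (b : 'I_m -> R) : Prop :=
  forall v : 'I_m -> R, \sum_j b j * v j ^+ 2 = 0 -> forall j, v j = 0.

(** The coefficient of [X^(2k)] in [\sum_j b_j v_j^2] is [\sum_j b_j (v_j)_k^2], so anisotropy over
    [R] kills every coefficient of every [v_j]. *)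
Lemma ring_anisotropic_poly (R : comNzRingType) (R2 : 2%N \in [pchar R])
    (b : 'I_m -> R) :
  ring_anisotropic R b -> ring_anisotropic {poly R} (fun j => (b j)%:P).
Proof.
move=> b_an v v0 j; apply/polyP => k; rewrite coef0.
apply: (b_an (fun j => (v j)`_k)); rewrite -[RHS](coef0 R (k * 2)) -v0 coef_sum.
by apply: eq_bigr => i _; rewrite coefCM coef_sqr_pchar2.
Qed.

Lemma ring_anisotropic_mpoly (R : comNzRingType) (R2 : 2%N \in [pchar R])
    (n : nat) (b : 'I_m -> R) :
  ring_anisotropic R b -> ring_anisotropic {mpoly R[n]} (fun j => (b j)%:MP).
Proof.
move=> b_an v v0 j; apply/mpolyP => k; rewrite mcoeff0.
apply: (b_an (fun j => (v j)@_k)).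
rewrite -[RHS](mcoeff0 R (k *+ 2)%MM) -v0 raddf_sum /=.
by apply: eq_bigr => i _; rewrite mcoeffCM mcoeff_sqr_pchar2.
Qed.

Lemma anisotropic_ring (F : fieldType) (b : 'rV[F]_m) :
  anisotropic b -> ring_anisotropic F (b 0).
Proof.
move=> b_an v v0 j; apply/eqP/negPn/negP => nzj; apply: b_an.
exists (\row_i v i).
  by apply/eqP => /rowP/(_ j)/eqP; rewrite !mxE (negPf nzj).
by rewrite -[RHS]v0; apply: eq_bigr => i _; rewrite mxE.
Qed.

End DiagonalAnisotropy.

(** * Divisibility by the quadric polynomial *)

Lemma anisotropic_coef_neq0 (F : fieldType) n (a : 'rV[F]_n) (i : 'I_n) :
  anisotropic a -> a 0 i != 0.
Proof.
move=> a_an; apply/negP => /eqP ai0; apply: a_an; exists (delta_mx 0 i).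
  by apply/eqP => /rowP/(_ i)/eqP; rewrite !mxE !eqxx oner_eq0.
rewrite /qval big1 // => j _; rewrite mxE /=.
by case: eqP => [->|_]; rewrite ?ai0 ?mul0r // expr0n mulr0.
Qed.

Lemma mpoly_rmorph_eq (R : comNzRingType) (S : nzRingType) (n : nat)
    (f g : {rmorphism {mpoly R[n]} -> S}) :
  (forall c, f c%:MP = g c%:MP) -> (forall i, f 'X_i = g 'X_i) -> f =1 g.
Proof.
move=> fgC fgX h; rewrite [h]mpolyE !rmorph_sum; apply: eq_bigr => k _ /=.
rewrite -mul_mpolyC !rmorphM fgC mpolyXE_id !rmorph_prod; congr (_ * _).
by apply: eq_bigr => i _; rewrite !rmorphXn fgX.
Qed.

(* Dividing by [p], viewed as a quadratic polynomial in one variable [X_i],   *)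
(* lets us assume that all [f j] have degree at most 1 in [X_i].  Then the    *)
(* left-hand side has degree at most 2, but [p ^ 2] has degree 4.             *)
Lemma quadric_dvd_of_sqr_dvd (F : fieldType) (F2 : 2%N \in [pchar F])
    n m (p : 'rV[F]_n) (q : 'rV[F]_m)
    (i : 'I_n) (f : 'I_m -> {mpoly F[n]}) (h : {mpoly F[n]}) :
  anisotropic p -> anisotropic q ->
  \sum_j (q 0 j)%:MP * f j ^+ 2 = h * quadric_poly p ^+ 2 ->
  forall j, exists r, f j = r * quadric_poly p.
Proof.
move=> p_an q_an fh.
pose R := {mpoly F[n]}; pose T := {poly R}.
(* [psi] reads [X_i] as the variable of [T] and the other [X_l] as constants; substituting [X_i] for
   that variable undoes it. *)
pose x l : T := if l == i then 'X else ('X_l)%:P.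
have [psi psiC psiX] : exists2 psi : {rmorphism R -> T},
    forall c, psi c%:MP = c%:MP%:P & forall l, psi 'X_l = x l.
  exists (mmap (polyC \o @mpolyC n F) x) => [c|l] /=; first by rewrite mmapC.
  by rewrite mmapX mmap1U.
have psiK f0 : (psi f0).['X_i] = f0.
  pose ev : {rmorphism T -> R} := horner_eval ('X_i : R).
  apply: (mpoly_rmorph_eq _ _ _ (ev \o psi) idfun) => [c|l].
    by rewrite /= psiC /horner_eval hornerC.
  rewrite /= psiX /horner_eval /x.
  by case: eqP => [->|_]; rewrite ?hornerX ?hornerC.
have R2 : 2%N \in [pchar R] by exact: (rmorph_pchar (@mpolyC n F) F2).
have T2 : 2%N \in [pchar T] by rewrite pchar_poly.
have pi0 := anisotropic_coef_neq0 _ _ _ i p_an.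
(* Scaling by the inverse of [p_i] makes [p] monic in [X_i], so division with remainder works over
   the ring [R]. *)
pose u : R := (p 0 i)^-1%:MP.
have [c psi_p] : exists c : R,
    psi (u * quadric_poly p) = 'X^2 + c%:P.
  exists (u * \sum_(l < n | l != i) (p 0 l)%:MP * 'X_l ^+ 2).
  rewrite /quadric_poly (bigD1 i) //=.
  under eq_bigr do rewrite -mul_mpolyC.
  rewrite -mul_mpolyC mulrDr mulrA /u -mpolyCM mulVf // mpolyC1 mul1r.
  rewrite rmorphD rmorphXn psiX /x eqxx; congr (_ + _).
  rewrite !rmorphM !rmorph_sum psiC /=; congr (_ * _).
  apply: eq_bigr => l nli.
  by rewrite rmorphM rmorphXn psiC psiX /x (negPf nli) polyCM polyC_exp.
set M : T := 'X^2 + c%:P in psi_p.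
have Mmon : M \is monic by exact: monicXnaddC.
have szM : size M = 3%N by exact: size_XnaddC.
pose Q j := Pdiv.CommonRing.rdivp (psi (f j)) M.
pose r j := Pdiv.CommonRing.rmodp (psi (f j)) M.
have fE j : psi (f j) = Q j * M + r j by exact: Pdiv.RingMonic.rdivp_eq.
have szr j : (size (r j) <= 2)%N.
  by rewrite -ltnS -szM Pdiv.CommonRing.ltn_rmodp -size_poly_gt0 szM.
have psi_pM : psi (quadric_poly p) = (p 0 i)%:MP%:P * M.
  rewrite -psi_p rmorphM mulrA -psiC -rmorphM /u -mpolyCM mulfV //.
  by rewrite mpolyC1 rmorph1 mul1r.
pose qT (v : 'I_m -> T) := \sum_j (q 0 j)%:MP%:P * v j ^+ 2.
(* Squaring is additive, so [qT] of [psi f] is [M ^+ 2 * qT Q + qT r], and [M ^+ 2] divides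
   [qT r]. *)
have [g rg] : exists g, qT r = g * M ^+ 2.
  exists (psi h * (p 0 i)%:MP%:P ^+ 2 - qT Q).
  rewrite mulrBl -mulrA -exprMn -psi_pM -rmorphXn -rmorphM -fh rmorph_sum.
  apply/eqP; rewrite eq_sym subr_eq /qT mulr_suml -big_split /=; apply/eqP.
  apply: eq_bigr => j _; rewrite rmorphM rmorphXn psiC fE.
  by rewrite -(pFrobenius_autE T2) rmorphD /= !pFrobenius_autE mulrDr addrC
             exprMn mulrA.
have r0 : forall j, r j = 0.
  have /(ring_anisotropic_poly _ _ R2) an :=
    ring_anisotropic_mpoly _ _ F2 n _ (anisotropic_ring _ _ _ q_an).
  apply: an; rewrite -/(qT r) rg.
  have szq : (size (qT r) <= 3)%N.
    apply: (leq_trans (size_sum _ _ _)); apply/bigmax_leqP => j _.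
    apply: (leq_trans (size_polyMleq _ _)).
    have szc := size_polyC_leq1 ((q 0 j)%:MP : R).
    have sz2 : (size (r j ^+ 2) <= 3)%N.
      apply: (leq_trans (size_poly_exp_leq _ _)); rewrite ltnS.
      by apply: leq_trans (leq_mul (_ : _ <= 1)%N (leqnn 2)) _ => //;
         case: (size (r j)) (szr j) => [|[|[]]].
    by rewrite -subn1 leq_subLR; apply: leq_trans (leq_add szc sz2) _.
  have szM2 : size (M ^+ 2) = 5%N.
    by rewrite size_Mmonic ?monic_neq0 // szM.
  have [->|g0] := eqVneq g 0; first by rewrite mul0r.
  move: szq; rewrite rg size_Mmonic ?monic_exp // szM2.
  have : (0 < size g)%N by rewrite size_poly_gt0.
  by case: (size g) => // k _; rewrite addnC.
move=> j; exists ((Q j).['X_i] * u).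
rewrite -[LHS]psiK fE r0 addr0 hornerM -psi_p psiK; exact: mulrA.
Qed.

(** * Subforms from represented values *)

(** Vectors representing the coefficients of [b] are the rows of [B]. Additivity makes
    [v |-> v *m B] preserve values, anisotropy of [b] makes it injective, and any complement of its
    image is orthogonal to it because the polar form is zero. *)
Lemma subform_of_values (F : fieldType) (F2 : 2%N \in [pchar F])
    m n (b : 'rV[F]_m) (a : 'rV[F]_n) :
  anisotropic b -> (forall i, exists v, b 0 i = qval a v) -> subform b a.
Proof.
move=> b_an /fin_all_exists[z bz].
pose B : 'M[F]_(m, n) := \matrix_i z i.
have qB v : qval a (v *m B) = qval b v.
  rewrite mulmx_sum_row (qval_sum F2); apply: eq_bigr => i _.
  by rewrite qvalZ rowK -bz mulrC.
have freeB : row_free B.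
  rewrite -kermx_eq0; apply/rowV0P => v /sub_kermxP vB.
  apply/eqP/negPn/negP => v0; apply: b_an; exists v => //.
  by rewrite -qB vB qval0.
pose C := row_base (B^C)%MS; pose M := col_mx B C.
have fullM : row_full M.
  rewrite -sub1mx (submx_trans (_ : _ <= B + B^C)%MS) //.
    by rewrite sub1mx addsmx_compl_full.
  by rewrite -addsmxE addsmxS // eq_row_base.
have freeM : row_free M.
  move: fullM; rewrite /row_free /row_full => /eqP ->.
  by rewrite mxrank_compl (eqP freeB) subnKC // -(eqP freeB) rank_leq_col.
exists (\rank (B^C)%MS), (\row_i qval a (row i C)), (pinvmx M).
have KM : pinvmx M *m M = 1%:M by rewrite mulVpmx.
have MK : M *m pinvmx M = 1%:M by rewrite mulmxVp.
split; [by apply/row_freeP; exists M | by apply/row_fullP; exists M |].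
move=> v; rewrite -{2}[v]mulmx1 -KM mulmxA.
move: (v *m pinvmx M) => w; rewrite -[w]hsubmxK mul_row_col (qvalD F2) qB.
rewrite /orthogonal_sum {1}/qval big_split_ord /=; congr (_ + _).
  by apply: eq_bigr => k _; rewrite !row_mxEl.
rewrite mulmx_sum_row (qval_sum F2); apply: eq_bigr => k _.
by rewrite !row_mxEr mxE qvalZ mulrC.
Qed.

(** * Homogeneity and the quadric polynomial *)

Lemma quadric_poly_neq0 (F : fieldType) n (p : 'rV[F]_n) (i : 'I_n) :
  anisotropic p -> quadric_poly p != 0.
Proof.
move=> p_an; apply/eqP => /(congr1 (mcoeff (U_(i) *+ 2)%MM)).
rewrite mcoeff0 /quadric_poly raddf_sum /= (bigD1 i) //= big1 => [|l nli].
  rewrite mcoeffZ mcoeffXn eqxx mulr1 addr0 => /eqP.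
  by rewrite (negPf (anisotropic_coef_neq0 _ _ _ i p_an)).
rewrite mcoeffZ mcoeffXn; case: eqP => [/mnmP/(_ i)|]; last by rewrite mulr0.
by rewrite !mulmnE !mnmE eqxx (negPf nli).
Qed.

Lemma quadric_poly_homog (F : fieldType) n (p : 'rV[F]_n) :
  quadric_poly p \is 2.-homog.
Proof.
apply: rpred_sum => l _; apply: rpredZ; rewrite -[2%N]mul1n.
by apply: dhomogMn; rewrite dhomogX /= mdeg1.
Qed.

(** Multiplication by [p] shifts each homogeneous component of [h] by [d], so only degree [e - d]
    survives. If [e < d], then [h = 0], so truncated subtraction is harmless. *)
Lemma homog_factor (R : idomainType) n (p h : {mpoly R[n]}) d e :
  p != 0 -> p \is d.-homog -> h * p \is e.-homog -> h \is (e - d).-homog.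
Proof.
move=> p0 p_d hp_e.
pose c (k : nat) := pihomog mdeg k h.
have := pihomog_partitionE (leqnn (mmeasure mdeg h)).
move: (mmeasure mdeg h) => s hE.
have zc (k : 'I_s) : (k + d)%N != e -> c k = 0.
  move=> nkd; have : pihomog mdeg (k + d) (h * p) = c k * p.
    rewrite {1}hE mulr_suml raddf_sum (bigD1 k) //= big1 ?addr0 => [|l nlk].
      by apply: pihomog_dE; apply: dhomogM => //; apply: pihomogP.
    rewrite (pihomog_ne0 (d := (l + d)%N)) ?eqn_add2r //.
    by apply: dhomogM => //; apply: pihomogP.
  rewrite (pihomog_ne0 (d := e)) 1?eq_sym // => /esym/eqP.
  by rewrite mulf_eq0 (negPf p0) orbF => /eqP.
rewrite hE; apply: rpred_sum => k _; rewrite -/(c k).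
have [<-|/zc->] := eqVneq (k + d)%N e; last exact: rpred0.
by rewrite addnK; apply: pihomogP.
Qed.

(** * Evaluation at the generic point *)

Section GenericPoint.
Variables (F K : fieldType) (iota : {rmorphism F -> K}).
Hypothesis F2 : 2%N \in [pchar F].
Variables (n : nat) (p : 'rV[F]_n) (x : 'I_n -> K).
Hypothesis p_an : anisotropic p.

Variable ev : {rmorphism {mpoly F[n]} -> K}.
Hypothesis evC : forall c, ev c%:MP = iota c.
Hypothesis evX : forall i, ev 'X_i = x i.

Hypothesis x_neq0 : exists i, x i != 0.
Hypothesis x_ideal : forall d (f : {mpoly F[n]}), f \is d.-homog ->
  (ev f = 0 <-> exists g, f = g * quadric_poly p).
Hypothesis x_gen :
  field_generated iota (fun y => exists i j, x j != 0 /\ y = x i / x j).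

Lemma ev_quadric_poly : ev (quadric_poly p) = 0.
Proof.
by apply/(x_ideal _ _ (quadric_poly_homog _ _ p)); exists 1; rewrite mul1r.
Qed.

(** These fractions form a subfield containing [F] and the generators [x_i / x_j]. *)
Lemma homog_fraction (y : K) : exists d (f g : {mpoly F[n]}),
  [/\ f \is d.-homog, g \is d.-homog, ev g != 0 & y = ev f / ev g].
Proof.
pose D : {pred K} := fun y => `[< exists d (f g : {mpoly F[n]}),
  [/\ f \is d.-homog, g \is d.-homog, ev g != 0 & y = ev f / ev g] >].
have C_homog c : (c%:MP : {mpoly F[n]}) \is 0.-homog.
  by rewrite -[c%:MP]mulr1 mul_mpolyC; apply: rpredZ; apply: dhomog1.
have DC c : iota c \in D.
  apply/asboolP; exists 0%N, c%:MP, 1.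
  by split; rewrite ?rmorph1 ?oner_eq0 ?evC ?divr1 // dhomog1.
apply/asboolP; apply: (x_gen D) => //.
  split; first by rewrite -(rmorph1 iota) DC.
    move=> u v /asboolP[d [f [g [hf hg g0 ->]]]].
    move=> /asboolP[d' [f' [g' [hf' hg' g0' ->]]]].
    apply/asboolP; exists (d + d')%N, (f * g' - f' * g), (g * g').
    split.
    - by apply: rpredB; rewrite ?(mulrC f') dhomogM.
    - exact: dhomogM.
    - by rewrite rmorphM mulf_neq0.
    by rewrite rmorphB !rmorphM -!mulNr addf_div.
  move=> u v /asboolP[d [f [g [hf hg g0 ->]]]].
  move=> /asboolP[d' [f' [g' [hf' hg' g0' ->]]]].
  (* Division by zero gives zero, which must also lie in [D]. *)
  have [->|f0'] := eqVneq (ev f') 0.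
    by rewrite mul0r invr0 mulr0 -(rmorph0 iota) DC.
  apply/asboolP; exists (d + d')%N, (f * g'), (g * f').
  split; [exact: dhomogM|exact: dhomogM|by rewrite rmorphM mulf_neq0|].
  by rewrite invf_div mulf_div !rmorphM.
move=> _ [i [j [xj0 ->]]]; apply/asboolP; exists 1%N, 'X_i, 'X_j.
by split; rewrite ?evX // dhomogX /= mdeg1.
Qed.

Lemma homog_fractions (I : finType) (w : I -> K) :
  exists d (g : {mpoly F[n]}) (f : I -> {mpoly F[n]}),
  [/\ g \is d.-homog, ev g != 0
    & forall i, f i \is d.-homog /\ w i = ev (f i) / ev g].
Proof.
suff H (s : seq I) : exists d (g : {mpoly F[n]}) (f : I -> {mpoly F[n]}),
    [/\ g \is d.-homog, ev g != 0
      & {in s, forall i, f i \is d.-homog /\ w i = ev (f i) / ev g}].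
  have [d [g [f [hg g0 hf]]]] := H (enum I); exists d, g, f.
  by split=> // i; apply: hf; rewrite mem_enum.
elim: s => [|i s [d [g [f [hg g0 hf]]]]].
  by exists 0%N, 1, (fun _ => 0); rewrite dhomog1 rmorph1 oner_eq0.
have [d' [f' [g' [hf' hg' g0' wi]]]] := homog_fraction (w i).
exists (d + d')%N, (g * g'), (fun j => if j == i then g * f' else f j * g').
split; [exact: dhomogM | by rewrite rmorphM mulf_neq0 |].
move=> j; rewrite inE; have [->|_ /hf[hj ->]] := eqVneq j i => [_|].
  by split; rewrite ?dhomogM // wi !rmorphM -mulf_div divff // mul1r.
by split; rewrite ?dhomogM // !rmorphM -mulf_div divff // mulr1.
Qed.

(** * Construction of [tau] *)

Variables (m : nat) (q : 'rV[F]_m).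

Let P := quadric_poly p.
Let q_poly (f : 'I_m -> {mpoly F[n]}) := \sum_j (q 0 j)%:MP * f j ^+ 2.

Lemma ev_q_poly f : ev (q_poly f) = qval (map_mx iota q) (\row_j ev (f j)).
Proof.
rewrite rmorph_sum; apply: eq_bigr => j _.
by rewrite !mxE rmorphM rmorphXn evC.
Qed.

Lemma q_poly_homog d f :
  (forall j, f j \is d.-homog) -> q_poly f \is (d * 2).-homog.
Proof.
move=> hf; apply: rpred_sum => j _; rewrite mul_mpolyC; apply: rpredZ.
exact: dhomogMn.
Qed.

(* Compare the coefficients of [t ^ 2] in [q (f (x + t e_i))] and in          *)
(* [h (x + t e_i) * p (x + t e_i)], where [p (x + t e_i) = p_i t ^ 2].        *)
Lemma coef_mul_quotient_value (f : 'I_m -> {mpoly F[n]}) (h : {mpoly F[n]}) :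
  q_poly f = h * P -> forall i, exists z,
  iota (p 0 i) * ev h = qval (map_mx iota q) z.
Proof.
move=> fh i.
have T2 : 2%N \in [pchar {poly K}] by rewrite pchar_poly (rmorph_pchar iota).
have [phi phiC phiX] : exists2 phi : {rmorphism {mpoly F[n]} -> {poly K}},
    forall c, phi c%:MP = (iota c)%:P
    & forall l, phi 'X_l = (x l)%:P + (l == i)%:R%:P * 'X.
  exists (mmap (polyC \o iota) (fun l => (x l)%:P + (l == i)%:R%:P * 'X)).
    by move=> c /=; rewrite mmapC.
  by move=> l /=; rewrite mmapX mmap1U.
have phi0 f0 : (phi f0)`_0 = ev f0.
  rewrite -horner_coef0.
  apply: (mpoly_rmorph_eq _ _ _ (horner_eval 0 \o phi) ev) => [c|l].
    by rewrite evC /= phiC /horner_eval hornerC.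
  by rewrite evX /= phiX /horner_eval !hornerE.
have phiP : phi P = (iota (p 0 i))%:P * 'X^2.
  have PE : P = \sum_l (p 0 l)%:MP * 'X_l ^+ 2.
    by apply: eq_bigr => l _; rewrite mul_mpolyC.
  have evP : \sum_l iota (p 0 l) * x l ^+ 2 = 0.
    rewrite -[RHS]ev_quadric_poly -/P PE rmorph_sum; apply: eq_bigr => l _.
    by rewrite rmorphM rmorphXn evC evX.
  transitivity ((\sum_l iota (p 0 l) * x l ^+ 2)%:P
      + \sum_l (l == i)%:R%:P * ((iota (p 0 l))%:P * 'X^2)).
    rewrite PE 2!rmorph_sum -big_split; apply: eq_bigr => l _ /=.
    rewrite rmorphM rmorphXn phiC phiX -(pFrobenius_autE T2) rmorphD /=.
    rewrite !pFrobenius_autE exprMn mulrDr polyCM polyC_exp; congr (_ + _).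
    case: (l == i) => /=; first by rewrite mulr1n polyC1 expr1n !mul1r.
    by rewrite mulr0n polyC0 expr0n !mul0r mulr0.
  rewrite evP polyC0 add0r (bigD1 i) //= eqxx mul1r big1 ?addr0 // => l /negPf->.
  by rewrite mul0r.
(* The entries are the coefficients of [t], that is, the partial derivatives of the [f j] along
   [X_i] at [x]. *)
exists (\row_j (phi (f j))`_1).
have := congr1 (fun g => (phi g)`_2) fh.
rewrite /q_poly rmorph_sum rmorphM phiP coef_sum mulrCA coefCM coefMXn /= phi0.
move=> <-; apply: eq_bigr => j _.
rewrite rmorphM rmorphXn phiC coefCM !mxE -[2%N]mul1n.
by rewrite (coef_sqr_pchar2 _ (rmorph_pchar iota F2)).
Qed.

Hypothesis q_an : anisotropic q.

(* For homogeneous lifts [f k] to [F[X]] of a basis of the isotropic vectors  *)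
(* of [q_K], the coefficients of [tau] are the values at the generic point of *)
(* the quotients [q (f k) / p].                                               *)
Lemma exists_tau : exists d (tau : 'rV[K]_d),
  [/\ anisotropic tau, d = \rank (isotropic_space (map_mx iota q))
    & forall i k, exists z,
        iota (p 0 i) * tau 0 k = qval (map_mx iota q) z].
Proof.
set qK := map_mx iota q.
have K2 := rmorph_pchar iota F2.
have := eq_row_base (isotropic_space qK).
have := row_base_free (isotropic_space qK).
move: (row_base _) => B freeB eqB.
have [i0 _] := x_neq0.
have P0 : P != 0 by apply: (quadric_poly_neq0 _ _ _ i0 p_an).
have P_homog : P \is 2.-homog by apply: quadric_poly_homog.
(* A common denominator [g] lifts the rows of [B], scaled by [ev g], to homogeneous polynomials. *)
have [d [g [f [_ g0 hf]]]] :=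
  homog_fractions _ (fun kj : 'I__ * 'I_m => B kj.1 kj.2).
have fE k : \row_j ev (f (k, j)) = ev g *: row k B.
  apply/rowP => j; rewrite !mxE.
  have [_ /= ->] := hf (k, j).
  by rewrite mulrC divfK.
(* Row [k] of [B] is isotropic, so [q] of its lift vanishes at [x] and is divisible by [P]. *)
have /choice[h qf] k : exists h, q_poly (fun j => f (k, j)) = h * P.
  apply/(x_ideal (d * 2)).
    by apply: q_poly_homog => j; case: (hf (k, j)).
  rewrite ev_q_poly fE qvalZ.
  suff -> : qval qK (row k B) = 0 by rewrite mulr0.
  apply/(isotropic_spaceP K2); rewrite -eqB.
  exact: row_sub.
exists _, (\row_k ev (h k)); split=> //; last first.
  by move=> i k; rewrite mxE; apply: coef_mul_quotient_value (qf k) i.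
case=> c /eqP c0 qc; apply: c0.
(* An isotropic vector [c] of [tau] is cleared of denominators in the same way; [fe] then lifts a
   multiple of [c *m B]. *)
have [d' [e' [e [_ e'0 he]]]] := homog_fractions _ (c 0).
pose fe j := \sum_k e k * f (k, j).
pose h' := \sum_k e k ^+ 2 * h k.
have R2 : 2%N \in [pchar {mpoly F[n]}] by exact: (rmorph_pchar (@mpolyC n F) F2).
have fe_homog j : fe j \is (d' + d).-homog.
  apply: rpred_sum => k _; apply: dhomogM; first by case: (he k).
  by case: (hf (k, j)).
have qfe : q_poly fe = h' * P.
  rewrite /h' mulr_suml /q_poly.
  under eq_bigr do rewrite (sqr_sum_pchar2 _ R2) mulr_sumr.
  rewrite exchange_big; apply: eq_bigr => k _ /=.
  rewrite -mulrA -qf mulr_sumr; apply: eq_bigr => j _.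
  by rewrite exprMn mulrCA.
have h'0 : ev h' = 0.
  transitivity (ev e' ^+ 2 * qval (\row_k ev (h k)) c); last by rewrite qc mulr0.
  rewrite rmorph_sum mulr_sumr; apply: eq_bigr => k _.
  rewrite rmorphM rmorphXn mxE; have [_ ->] := he k.
  by rewrite mulrCA -exprMn mulrC [ev e' * _]mulrC divfK.
(* Homogeneity of [h'] lets the ideal property apply again, so [P ^+ 2] divides [q_poly fe]. *)
have [h'' h'E] : exists h'', h' = h'' * P.
  apply/(x_ideal ((d' + d) * 2 - 2)) => //.
  by apply: homog_factor P0 P_homog _; rewrite -qfe; apply: q_poly_homog.
have fe0 j : ev (fe j) = 0.
  have := quadric_dvd_of_sqr_dvd _ F2 _ _ p q i0 fe h'' p_an q_an.
  move=> /(_ _ j)[|r ->]; first by rewrite -[LHS]/(q_poly fe) qfe h'E -mulrA.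
  by rewrite rmorphM ev_quadric_poly mulr0.
(* At [x], [fe] equals [ev e' * ev g] times [c *m B]; its vanishing gives [c *m B = 0], hence
   [c = 0]. *)
apply: (row_free_inj freeB); rewrite mul0mx; apply/rowP => j; rewrite !mxE.
apply: (mulfI e'0); apply: (mulfI g0); rewrite !mulr0 -[RHS](fe0 j).
rewrite rmorph_sum !mulr_sumr; apply: eq_bigr => k _.
rewrite rmorphM; have [_ ->] := he k; have [_ /= ->] := hf (k, j).
by field; rewrite e'0 g0.
Qed.

End GenericPoint.

(** * Isotropy index, tensor products and the theorem *)

Lemma isotropy_index_rank (F : fieldType) (F2 : 2%N \in [pchar F])
    n (a : 'rV[F]_n) :
  isotropy_index a = \rank (isotropic_space a).
Proof.
apply/eqP; rewrite eqn_leq; apply/andP; split.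
  apply/bigmax_leqP => d /asboolP[U tiU <-]; apply: mxrankS.
  by apply/row_subP => i; apply/(isotropic_spaceP F2)/tiU/row_sub.
have lt_rn : (\rank (isotropic_space a) < n.+1)%N by rewrite ltnS rank_leq_row.
apply: (bigmax_sup (Ordinal lt_rn)) => //; apply/asboolP.
by exists (isotropic_space a) => // v /(isotropic_spaceP F2).
Qed.

Lemma purely_transcendental_id (F : fieldType) :
  purely_transcendental (idfun : {rmorphism F -> F}).
Proof.
(* With an empty transcendence basis, only constant polynomials have to be tested. *)
exists (fun _ => False) => [k t _ tB f|D _ DF _ y]; last exact: DF.
case: k => [|k] in t tB f *; last by case: (tB ord0).
by rewrite (nvar0_mpolyC f) map_mpolyC mevalC /= => ->.
Qed.

Lemma an_coef_value (F : fieldType) n (a : 'rV[F]_n) i :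
  exists v, an a 0 i = qval a v.
Proof. by rewrite mxE; eexists. Qed.

(** Values of [q] are closed under sums and multiplication by squares. Each coefficient of the
    anisotropic part of the tensor product is a sum of squares times products [p_i tau_k], hence a
    value of [q]. *)
Lemma tensor_subform_of_values (F : fieldType) (F2 : 2%N \in [pchar F])
    n d m (p : 'rV[F]_n) (tau : 'rV[F]_d) (q : 'rV[F]_m) :
  (forall i k, exists z, p 0 i * tau 0 k = qval q z) ->
  subform (an (tensor (an p) tau)) (an q).
Proof.
move=> ptau.
have valS I (r : seq I) (c b : I -> F) : (forall i, exists z, b i = qval q z) ->
    exists z, \sum_(i <- r) c i ^+ 2 * b i = qval q z.
  move=> bq; elim: r => [|i r [z IH]].
    by exists 0; rewrite big_nil qval0.
  have [z' b_i] := bq i; exists (c i *: z' + z).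
  by rewrite big_cons (qvalD F2) qvalZ IH b_i.
apply: (subform_of_values _ F2) => [|i]; first exact: anisotropic_an.
suff [z ->] : exists z, an (tensor (an p) tau) 0 i = qval q z.
  by exists (z *m an_proj q); rewrite (qval_an F2).
have [v ->] := an_coef_value _ _ (tensor (an p) tau) i.
rewrite /qval; under eq_bigr do rewrite mulrC.
apply: (valS) => l; case/mxvec_indexP: l => k l.
rewrite mxvecE mxE; have [u ->] := an_coef_value _ _ p k.
rewrite /qval mulr_suml; under eq_bigr do rewrite mulrAC mulrC.
exact: valS.
Qed.

Theorem theorem6p6 (F : fieldType) (charF : 2%N \in [pchar F])
    (n m : nat) (p : 'rV[F]_n) (q : 'rV[F]_m)
    (n_ge2 : (2 <= n)%N) (m_ge2 : (2 <= m)%N)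
    (p_an : anisotropic p) (q_an : anisotropic q)
    (Fp : fieldType) (iota : {rmorphism F -> Fp})
    (FpP : is_quadric_function_field iota p)
    (q_iso : isotropic (map_mx iota q)) :
  exists (L : fieldType) (jL : {rmorphism F -> L}),
    purely_transcendental jL /\
    exists (Lp : fieldType) (iotaL : {rmorphism L -> Lp}),
      is_quadric_function_field iotaL (map_mx jL p) /\
      exists (d : nat) (tau : 'rV[Lp]_d),
        let pL := map_mx jL p in
        let qLp := map_mx iotaL (map_mx jL q) in
        [/\ anisotropic tau,
            d = isotropy_index qLp
          & subform (an (tensor (first_kernel iotaL pL) tau)) (an qLp)].
Proof.
exists F, idfun; split; first exact: purely_transcendental_id.
exists Fp, iota; rewrite !map_mx_id //; split=> //.
have Fp2 := rmorph_pchar iota charF.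
have [x [x0 x_ideal x_gen]] := FpP.
have evC c : (map_mpoly iota (c%:MP : {mpoly F[n]})).@[x] = iota c.
  by rewrite map_mpolyC mevalC.
have evX i : (map_mpoly iota ('X_i : {mpoly F[n]})).@[x] = x i.
  by rewrite map_mpolyX mevalXU.
have [d [tau [tau_an dE ptau]]] :=
  exists_tau _ _ iota charF _ p x p_an (meval x \o map_mpoly iota)
    evC evX x0 x_ideal x_gen _ q q_an.
exists d, tau; split=> //; first by rewrite isotropy_index_rank.
apply: tensor_subform_of_values => // i k.
by have [z zE] := ptau i k; exists z; rewrite mxE.
Qed.
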